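(* Let $G$ be a finite connected, nonbipartite, $R$-thin graph on at least $3$ vertices that is prime with respect to the weak product. Suppose $G$ admits a proper coloring with $\chi(G)$ colors having a color class $C_1$ such that no nontrivial automorphism of $G$ fixes every vertex of $C_1$. Then $\chi_D(G^{\times n})\le \chi(G)+1$ for every $n\ge4$.
   Context: The weak (direct) product $G\times H$ has vertex set $V(G)\times V(H)$, with $(g_1,h_1)$ adjacent to $(g_2,h_2)$ iff $g_1g_2\in E(G)$ and $h_1h_2\in E(H)$; $G^{\times n}$ denotes the $n$-fold weak product of $G$ with itself. A graph is $R$-thin if no two distinct vertices have the same open neighborhood. $K_1^s$ denotes a single vertex with a loop. A graph $G$ is prime (with respect to the weak product) if it is nontrivial and $G\cong G_1\times G_2$ implies $G_1\cong K_1^s$ or $G_2\cong K_1^s$. A coloring is distinguishing if the only graph automorphism mapping every color class onto itself is the identity; $\chi_D(G)$ is the minimum number of colors of a proper distinguishing coloring of $G$. *)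

(* Defs.v *)
(* Graphs: a finite vertex type T with a symmetric adjacency
   relation e : rel T (loops allowed, as needed for the weak product and K_1^s). *)
From mathcomp Require Import all_boot all_fingroup.
Set Implicit Arguments. Unset Strict Implicit. Unset Printing Implicit Defensive.

Definition ugraph (T : finType) (e : rel T) : Prop := symmetric e.

Definition simple_graph (T : finType) (e : rel T) : Prop :=
  symmetric e /\ irreflexive e.

Definition wprod (T1 T2 : finType) (e1 : rel T1) (e2 : rel T2) : rel (T1 * T2) :=
  fun u v => e1 u.1 v.1 && e2 u.2 v.2.

Definition wpow (T : finType) (e : rel T) (n : nat) : rel {ffun 'I_n -> T} :=
  fun f g => [forall i, e (f i) (g i)].
Arguments wpow {T} e n.

Definition giso (T1 T2 : finType) (e1 : rel T1) (e2 : rel T2) : Prop :=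
  exists f : T1 -> T2, bijective f /\ forall x y, e2 (f x) (f y) = e1 x y.

Definition K1s_rel : rel unit := fun _ _ => true.

Definition nontrivial (T : finType) : Prop := 1 < #|T|.

Definition wprime (T : finType) (e : rel T) : Prop :=
  nontrivial T /\
  forall (T1 T2 : finType) (e1 : rel T1) (e2 : rel T2),
    ugraph e1 -> ugraph e2 ->
    giso e (wprod e1 e2) -> giso e1 K1s_rel \/ giso e2 K1s_rel.

Definition gconnected (T : finType) (e : rel T) : Prop :=
  forall x y : T, connect e x y.

Definition proper_coloring (T : finType) (e : rel T) (k : nat) (c : T -> 'I_k) : Prop :=
  forall x y, e x y -> c x != c y.

Definition colorable (T : finType) (e : rel T) (k : nat) : Prop :=
  exists c : T -> 'I_k, proper_coloring e c.

Definition bipartite (T : finType) (e : rel T) : Prop := colorable e 2.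

Definition chromatic_number (T : finType) (e : rel T) (k : nat) : Prop :=
  colorable e k /\ forall j, colorable e j -> k <= j.

Definition R_thin (T : finType) (e : rel T) : Prop :=
  forall x y : T, (forall z, e x z = e y z) -> x = y.

Definition is_aut (T : finType) (e : rel T) (s : {perm T}) : Prop :=
  forall x y, e (s x) (s y) = e x y.

Definition distinguishing (T : finType) (e : rel T) (k : nat) (c : T -> 'I_k) : Prop :=
  forall s : {perm T}, is_aut e s -> (forall x, c (s x) = c x) -> s = 1%g.

Definition chiD_le (T : finType) (e : rel T) (k : nat) : Prop :=
  exists c : T -> 'I_k, proper_coloring e c /\ distinguishing e c.

(* Main.v *)
(**
  An automorphism of the power permutes coordinates and acts on each of them by
  an automorphism of G.  This rests on the Cartesian skeleton of Hammack and
  Imrich: a relation defined from neighbourhoods alone, connected on connected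
  nonbipartite graphs, whose edges change only one coordinate in every
  direct decomposition.  Any two decompositions therefore commute, and pulling
  one coordinate of the power back along an automorphism decomposes every other
  coordinate; primality of G makes that decomposition trivial.

  Colour x by the colour of x_0, and give a new colour to the x such that
  x_0, x_1 lie in C_1, x_1 <= x_0 in a fixed enumeration of the vertices, and
  the coordinates k >= 2 with x_k = x_0 form an initial segment.  The comparison
  of x_1 with x_0 pins down C_1 in coordinates 0 and 1; the initial segments
  pin down C_1 in the other coordinates and the order of the coordinates.
*)
Require Import Defs.
From mathcomp Require Import all_boot all_fingroup.
From mathcomp Require Import zify.
Set Implicit Arguments. Unset Strict Implicit. Unset Printing Implicit Defensive.

Lemma connect_sub_equiv (X : finType) (r : rel X) (P : X -> X -> Prop) :
  (forall x, P x x) -> (forall x y z, P x y -> P y z -> P x z) ->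
  (forall x y, r x y -> P x y) -> forall x y, connect r x y -> P x y.
Proof.
move=> Prefl Ptrans rP x y /connectP[p]; elim: p x => [|z p IHp] x /=.
  by move=> _ ->; apply: Prefl.
by case/andP=> /rP Pxz /IHp Pzy /Pzy; apply: Ptrans.
Qed.

(** * The Boolean square and the Cartesian skeleton *)

Section Skeleton.

Variables (X : finType) (E : rel X).

Definition nbr x := [set z | E x z].

Definition boolsq x y := nbr x :&: nbr y != set0.

(* [z] makes the edge [x y] dispensable when both [closer x y z] and [closer y x z]. *)
Definition closer x y z :=
  (nbr x :&: nbr y \proper nbr x :&: nbr z) ||
  ((nbr x \proper nbr z) && (nbr z \proper nbr y)).

Definition skel x y :=
  [&& x != y, boolsq x y & ~~ [exists z, closer x y z && closer y x z]].

(** A dispensable edge is replaced by the two-step walk through its witness [z], and both steps have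
    smaller [mu]. *)
Lemma boolsq_connect_skel x y : boolsq x y -> connect skel x y.
Proof.
(* Lexicographic: a larger common neighbourhood first, then smaller degrees. *)
pose mu x y := (#|X| - #|nbr x :&: nbr y|) * (#|X|.*2).+1 + (#|nbr x| + #|nbr y|).
have [m] := ubnP (mu x y); elim: m => // m IHm in x y *; rewrite ltnS => le_m Bxy.
have [-> //|neq_xy] := eqVneq x y.
case Sxy: (skel x y); first exact: connect1.
move: Sxy; rewrite /skel neq_xy Bxy /= => /negbFE/existsP[z /andP[Cxy Cyx]].
have muI u v u' v' : nbr u :&: nbr v \proper nbr u' :&: nbr v' -> mu u' v' < mu u v.
  move=> /proper_card; rewrite /mu => ltI.
  have := max_card (nbr u' :&: nbr v'); have := max_card (nbr u'); have := max_card (nbr v').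
  nia.
have nzI u v u' v' : nbr u :&: nbr v \proper nbr u' :&: nbr v' -> boolsq u' v'.
  by move=> /proper_card lt; rewrite /boolsq -card_gt0; apply: leq_trans lt.
apply: (@connect_trans _ _ z).
  case/orP: Cxy => [lt|/andP[xz zy]].
    by apply: IHm (nzI _ _ _ _ lt); apply: leq_trans (muI _ _ _ _ lt) le_m.
  (* The neighbourhoods of [x], [z], [y] increase strictly here, so both common neighbourhoods are
     that of [x] and only the degree term drops. *)
  have Ixz : nbr x :&: nbr z = nbr x by apply/setIidPl/proper_sub.
  have Ixy : nbr x :&: nbr y = nbr x by apply/setIidPl/(subset_trans (proper_sub xz))/proper_sub.
  apply: IHm; last by move: Bxy; rewrite /boolsq Ixz Ixy.
  apply: leq_trans le_m; rewrite /mu Ixz Ixy.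
  by have := proper_card zy; lia.
case/orP: Cyx => [lt|/andP[yz zx]].
  apply: IHm; last by rewrite /boolsq setIC; apply: nzI lt.
  by rewrite setIC [nbr y :&: _]setIC in lt; apply: leq_trans (muI _ _ _ _ lt) le_m.
have Izy : nbr z :&: nbr y = nbr y by apply/setIidPr/proper_sub.
have Ixy : nbr x :&: nbr y = nbr y by apply/setIidPr/(subset_trans (proper_sub yz))/proper_sub.
apply: IHm; last by move: Bxy; rewrite /boolsq Izy Ixy.
apply: leq_trans le_m; rewrite /mu Izy Ixy.
by have := proper_card zx; lia.
Qed.

(* A decomposition as a product of two factors, encoded by its mixing operation:
   [d x y] takes its first factor from [x] and its second from [y]. *)
Definition decomp (d : X -> X -> X) : Prop :=
  [/\ forall x, d x x = x,
      forall x y z, d (d x y) z = d x z,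
      forall x y z, d x (d y z) = d x z
    & forall x x' y y', E x x' -> E y y' -> E (d x y) (d x' y')].

Definition flipd (d : X -> X -> X) : X -> X -> X := fun x y => d y x.

(** Equality of first coordinates, stated without naming the factors; with [flipd d] it is equality
    of second coordinates. *)
Definition same (d : X -> X -> X) x y := forall z, d x z = d y z.

Lemma decomp_flip d : decomp d -> decomp (flipd d).
Proof. by case=> dxx dl dr dE; split; rewrite /flipd // => *; apply: dE. Qed.

Lemma same_trans d x y z : same d x y -> same d y z -> same d x z.
Proof. by move=> xy yz t; rewrite xy. Qed.

Lemma same_sym d x y : same d x y -> same d y x.
Proof. by move=> xy t; rewrite xy. Qed.

Lemma same_mix d x y : decomp d -> same d (d x y) x.
Proof. by case=> _ dl _ _ z. Qed.

Lemma same_mix_flip d x y : decomp d -> same (flipd d) (d x y) y.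
Proof. by case=> _ _ dr _ z; rewrite /flipd. Qed.

Lemma same_eq d x y : decomp d -> same d x y -> same (flipd d) x y -> x = y.
Proof. by case=> dxx _ _ _ sA sB; rewrite -(dxx x) sA; have := sB y; rewrite /flipd dxx. Qed.

Lemma same_mixr d x y z : same (flipd d) x y -> d z x = d z y.
Proof. by move=> sB; apply: sB. Qed.

Hypothesis thinE : R_thin E.
Hypothesis noisoE : forall x, exists y, E x y.

(* The relation of the first factor, read on representatives *)
Definition facrel (d : X -> X -> X) x w := [exists v, exists v', E (d x v) (d w v')].

Lemma facrelP d x w : reflect (exists v v', E (d x v) (d w v')) (facrel d x w).
Proof.
apply: (iffP existsP) => [[v /existsP[v' H]]|[v [v' H]]]; first by exists v, v'.
by exists v; apply/existsP; exists v'.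
Qed.

(** * The two factor relations of a decomposition *)

Section OneDecomp.

Variable d : X -> X -> X.
Hypothesis Dd : decomp d.

Let dxx x : d x x = x. Proof. by case: Dd. Qed.
Let dl x y z : d (d x y) z = d x z. Proof. by case: Dd. Qed.
Let dr x y z : d x (d y z) = d x z. Proof. by case: Dd. Qed.
Let dE x x' y y' : E x x' -> E y y' -> E (d x y) (d x' y').
Proof. by case: Dd => _ _ _; apply. Qed.

Local Notation EA := (facrel d).
Local Notation EB := (facrel (flipd d)).

(** The last clause of [decomp] merges edges witnessing each factor into one edge, so [E] is the
    direct product of its factor relations. *)
Lemma facrel_edge x w : E x w = EA x w && EB x w.
Proof.
apply/idP/andP=> [xw|[/facrelP[v [v' H]] /facrelP[u [u']]]].
  by split; apply/facrelP; exists x, w; rewrite /flipd !dxx.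
by rewrite /flipd => H'; have := dE H H'; rewrite !(dl, dr, dxx).
Qed.

Lemma facrel_mixl x y w : EA (d x y) w = EA x w.
Proof. by apply: eq_existsb => v; apply: eq_existsb => v'; rewrite dl. Qed.

Lemma facrel_mixr x y w : EA w (d x y) = EA w x.
Proof. by apply: eq_existsb => v; apply: eq_existsb => v'; rewrite dl. Qed.

Lemma facrel_flip_mixl x y w : EB (d x y) w = EB y w.
Proof. by apply: eq_existsb => v; apply: eq_existsb => v'; rewrite /flipd dr. Qed.

Lemma facrel_flip_mixr x y w : EB w (d x y) = EB w y.
Proof. by apply: eq_existsb => v; apply: eq_existsb => v'; rewrite /flipd dr. Qed.

Definition facE := (facrel_mixl, facrel_mixr, facrel_flip_mixl, facrel_flip_mixr).

Lemma same_facrel_flip x y : same (flipd d) x y -> EB x =1 EB y.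
Proof. by move=> s w; have := s x; rewrite /flipd dxx => ->; rewrite facE. Qed.

(** Factors inherit thinness: [d x z] and [d y z] have the same neighbours, since their second
    coordinates agree. *)
Lemma facrel_thin x y : EA x =1 EA y -> same d x y.
Proof.
move=> eqA z; suff -> : d x z = d y z by [].
by apply: thinE => w; rewrite !facrel_edge !facE eqA.
Qed.

Lemma facrel_exists x : exists w, EA x w.
Proof. by have [w] := noisoE x; rewrite facrel_edge => /andP[? _]; exists w. Qed.



End OneDecomp.

(** * Skeleton edges change one factor only *)

(** With A and B the factor neighbourhoods, passing from [y] to [d x y] replaces the meet of A(x)
    and A(y) by A(x) and keeps the meet of B(x) and B(y). Here [a] makes the growth strict, and [w]
    shows that the B part is nonempty. *)
Lemma nbr_mix_proper d x y w a : decomp d ->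
  E x w -> E y w -> facrel d x a -> ~~ facrel d y a ->
  nbr x :&: nbr y \proper nbr x :&: nbr (d x y).
Proof.
move=> Dd; rewrite !(facrel_edge Dd) => /andP[xA xB] /andP[yA yB] xa ya.
apply/properP; split.
  apply/subsetP=> u; rewrite !inE !(facrel_edge Dd) !(facE Dd).
  by move=> /andP[/andP[-> ->] /andP[_ ->]].
by exists (d a w); rewrite !inE !(facrel_edge Dd) !(facE Dd) ?xa ?xB ?yB ?(negPf ya).
Qed.

Lemma closer_mix d x y w a b : decomp d -> E x w -> E y w ->
  facrel d x a -> ~~ facrel d y a ->
  facrel (flipd d) y b -> ~~ facrel (flipd d) x b ->
  closer x y (d x y) && closer y x (d x y).
Proof.
move=> Dd xw yw xa ya yb xb; rewrite /closer (nbr_mix_proper Dd xw yw xa ya) /=.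
by rewrite (nbr_mix_proper (decomp_flip Dd) yw xw yb xb).
Qed.

(** When both factor neighbourhoods grow strictly from [x] to [y], that of [d y x] lies strictly
    between, which is the second alternative of [closer x y]. *)
Lemma closer_mix_chain d x y w a b : decomp d -> E x w -> E y w ->
  (forall u, facrel d x u -> facrel d y u) ->
  (forall u, facrel (flipd d) x u -> facrel (flipd d) y u) ->
  facrel d y a -> ~~ facrel d x a ->
  facrel (flipd d) y b -> ~~ facrel (flipd d) x b ->
  closer x y (d y x) && closer y x (d y x).
Proof.
move=> Dd xw yw sA sB ya xa yb xb; apply/andP; split; last first.
  by rewrite /closer (nbr_mix_proper Dd yw xw ya xa).
move: xw yw; rewrite !(facrel_edge Dd) => /andP[xA xB] /andP[yA yB].
rewrite /closer; apply/orP; right; apply/andP; split; apply/properP; split.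
- apply/subsetP=> u; rewrite !inE !(facrel_edge Dd) !(facE Dd).
  by case/andP=> /sA -> ->.
- by exists (d a w); rewrite !inE !(facrel_edge Dd) !(facE Dd) ?ya ?xB ?(negPf xa).
- apply/subsetP=> u; rewrite !inE !(facrel_edge Dd) !(facE Dd).
  by case/andP=> -> /sB ->.
by exists (d w b); rewrite !inE !(facrel_edge Dd) !(facE Dd) ?yA ?yb // (negPf xb) andbF.
Qed.

(** If A(x) is not inside A(y) and B(y) not inside B(x), or if both nest strictly the same way, a
    mixture of [x] and [y] makes the edge dispensable. Excluding this leaves equal neighbourhoods in
    one factor, hence equal coordinates by thinness. *)
Lemma skel_decomp d x y : decomp d -> skel x y -> same d x y \/ same (flipd d) x y.
Proof.
move=> Dd /and3P[_ /set0Pn[w]]; rewrite !inE => /andP[xw yw] /existsPn nodisp.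
pose sub (r : rel X) p q := [forall u, r p u ==> r q u].
have notsub r p q : ~~ sub r p q -> exists2 u, r p u & ~~ r q u.
  by move=> /forallPn[u]; rewrite negb_imply => /andP[? ?]; exists u.
have subP r p q : sub r p q -> forall u, r p u -> r q u.
  by move=> /forallP H u; apply/implyP.
have eqr r p q : sub r p q -> sub r q p -> r p =1 r q.
  by move=> pq qp u; apply/idP/idP; apply: subP.
have eqA : sub (facrel d) x y -> sub (facrel d) y x -> same d x y.
  by move=> *; apply: facrel_thin => //; apply: eqr.
have eqB : sub (facrel (flipd d)) x y -> sub (facrel (flipd d)) y x -> same (flipd d) x y.
  by move=> *; apply: facrel_thin (decomp_flip Dd) _ _ _; apply: eqr.
have D1 : sub (facrel d) x y \/ sub (facrel (flipd d)) y x.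
  apply/orP; apply: contraT; rewrite negb_or => /andP[/notsub[a xa ya] /notsub[b yb xb]].
  by have := nodisp (d x y); rewrite (closer_mix Dd xw yw xa ya yb xb).
have D2 : sub (facrel d) y x \/ sub (facrel (flipd d)) x y.
  apply/orP; apply: contraT; rewrite negb_or => /andP[/notsub[a ya xa] /notsub[b xb yb]].
  by have := nodisp (d y x); rewrite andbC (closer_mix Dd yw xw ya xa xb yb).
have [Axy|/notsub[a1 xa1 ya1]] := boolP (sub (facrel d) x y);
have [Ayx|/notsub[a2 ya2 xa2]] := boolP (sub (facrel d) y x).
- by left; apply: eqA.
- have Bxy : sub (facrel (flipd d)) x y by case: D2 => // /subP/(_ _ ya2); rewrite (negPf xa2).
  have [Byx|/notsub[b yb xb]] := boolP (sub (facrel (flipd d)) y x).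
    by right; apply: eqB.
  have := nodisp (d y x).
  by rewrite (closer_mix_chain Dd xw yw (subP _ _ _ Axy) (subP _ _ _ Bxy) ya2 xa2 yb xb).
- have Byx : sub (facrel (flipd d)) y x by case: D1 => // /subP/(_ _ xa1); rewrite (negPf ya1).
  have [Bxy|/notsub[b xb yb]] := boolP (sub (facrel (flipd d)) x y).
    by right; apply: eqB.
  have := nodisp (d x y); rewrite andbC.
  by rewrite (closer_mix_chain Dd yw xw (subP _ _ _ Ayx) (subP _ _ _ Byx) xa1 ya1 xb yb).
(* Neither inclusion holds in the first factor, so [D1] and [D2] give both in the second. *)
right; apply: eqB.
  by case: D2 => // /subP/(_ _ ya2); rewrite (negPf xa2).
by case: D1 => // /subP/(_ _ xa1); rewrite (negPf ya1).
Qed.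

(** Since [p] and [q] share their second coordinate, the inclusions can be read on first
    coordinates, and a witness over [z] yields one in the fibre of [p]. *)
Lemma closer_transl d p q z t w : decomp d -> same (flipd d) p q ->
  E p w -> E q w -> closer (d p z) (d q z) t -> closer p q (d t p).
Proof.
move=> Dd sB; rewrite !(facrel_edge Dd) => /andP[pw pwB] /andP[qw _].
have [z' zz'] := facrel_exists (decomp_flip Dd) z.
have qB u : facrel (flipd d) q u = facrel (flipd d) p u.
  by rewrite (same_facrel_flip Dd sB).
case/orP=> [/properP[/subsetP sub [u]]|/andP[/properP[/subsetP sub1 [u1]]]].
  rewrite !inE !(facrel_edge Dd) !(facE Dd) => /and3P[/andP[pu zu] tu _].
  rewrite pu zu andbT => nqu; apply/orP; left; apply/properP; split.
    apply/subsetP=> v; rewrite !inE !(facrel_edge Dd) !(facE Dd).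
    move=> /andP[/andP[pv pvB] /andP[qv _]].
    have := sub (d v z'); rewrite !inE !(facrel_edge Dd) !(facE Dd) pv qv zz' pvB /= andbT.
    by case/(_ isT)/andP.
  by exists (d u w); rewrite !inE !(facrel_edge Dd) !(facE Dd) ?qB ?pu ?pwB ?tu //= andbT.
rewrite !inE !(facrel_edge Dd) !(facE Dd) => /andP[tu1 tu1B] nu1.
case/properP=> /subsetP sub2 [u2].
rewrite !inE !(facrel_edge Dd) !(facE Dd) => /andP[qu2 zu2] nu2.
(* The second coordinates of [u1] and [u2] are adjacent where required, so strictness must come from
   the first ones. *)
have zB : facrel (flipd d) z u1.
  by have := sub2 u1; rewrite !inE !(facrel_edge Dd) !(facE Dd) tu1 tu1B; case/(_ isT)/andP.
have tB : facrel (flipd d) t u2.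
  have := sub1 (d w u2); rewrite !inE !(facrel_edge Dd) !(facE Dd) pw zu2.
  by case/(_ isT)/andP.
rewrite zB andbT in nu1; rewrite tB andbT in nu2.
apply/orP; right; apply/andP; split; apply/properP; split.
- apply/subsetP=> v; rewrite !inE !(facrel_edge Dd) !(facE Dd) => /andP[pv ->].
  have := sub1 (d v z'); rewrite !inE !(facrel_edge Dd) !(facE Dd) pv zz'.
  by case/(_ isT)/andP=> ->.
- by exists (d u1 w); rewrite !inE !(facrel_edge Dd) !(facE Dd) ?pwB ?tu1 ?(negPf nu1).
- apply/subsetP=> v; rewrite !inE !(facrel_edge Dd) !(facE Dd) qB => /andP[tv ->].
  have := sub2 (d v u1); rewrite !inE !(facrel_edge Dd) !(facE Dd) tv tu1B.
  by case/(_ isT)/andP=> ->.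
by exists (d u2 w); rewrite !inE !(facrel_edge Dd) !(facE Dd) ?qB ?pwB ?qu2 ?(negPf nu2).
Qed.

(** A witness [t] against the translated edge would pull back to [d t p], a witness against the
    original edge. *)
Lemma skel_transl d p q z : decomp d -> same (flipd d) p q ->
  skel p q -> skel (d p z) (d q z).
Proof.
move=> Dd sB /and3P[neq_pq /set0Pn[w]]; rewrite !inE => /andP[pw qw] /existsPn nodisp.
have [z' zz'] := noisoE z.
have [dxx dl dr dE] := Dd.
have dqp : d q p = q by have := sB q; rewrite /flipd dxx.
apply/and3P; split.
- apply: contra neq_pq => /eqP eqz; rewrite -[p]dxx -[X in _ == X]dqp.
  by rewrite -(dl p z) eqz dl.
- by apply/set0Pn; exists (d w z'); rewrite !inE !dE.
apply/existsPn=> t; apply: contra (nodisp (d t p)) => /andP[c1 c2].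
rewrite (closer_transl Dd sB pw qw c1) /=.
have := closer_transl Dd (same_sym sB) qw pw c2.
by congr closer; apply: esym; apply: sB.
Qed.

(** Were [x'] and [w'] to agree in the second coordinate instead, the two remaining sides would
    either give the claim or identify two distinct corners. *)
Lemma same_square g x w w' x' : decomp g -> same g x w ->
  skel x w -> skel w w' -> skel x x' -> skel x' w' -> x != w' -> w != x' ->
  same g x' w'.
Proof.
move=> Dg xw Sxw Sww' Sxx' Sx'w' xw' wx'.
have [neq_xw _ _] := and3P Sxw.
case: (skel_decomp Dg Sx'w') => // fx'w'.
case: (skel_decomp Dg Sww') => ww'; case: (skel_decomp Dg Sxx') => xx'.
- exact: same_trans (same_sym xx') (same_trans xw ww').
- case/eqP: xw'; apply: same_eq Dg _ _; first exact: same_trans ww'.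
  exact: same_trans fx'w'.
- case/eqP: wx'; apply: same_eq Dg _ _; last exact: same_trans (same_sym fx'w').
  exact: same_trans (same_sym xw) _.
case/eqP: neq_xw; apply: same_eq Dg xw _.
exact: same_trans xx' (same_trans fx'w' (same_sym ww')).
Qed.

(** * Any two decompositions commute *)

Hypothesis skel_conn : forall x y, connect skel x y.

(* Move along skeleton paths: inside a class of [g] from [x] to [w], and then
   from [p] to [z], where each step completes a square of the skeleton. *)
Lemma same_transl d g x w z : decomp d -> decomp g ->
  same g x w -> same g (d x z) (d w z).
Proof.
move=> Dd Dg xw.
have [gxx gl gr gE] := Dg; have [dxx dl dr dE] := Dd.
have edge p q : skel p q -> same g p q -> same g (d p z) (d q z).
  move=> Spq gpq; have [neq_pq _ _] := and3P Spq.
  case: (skel_decomp Dd Spq) => [dpq|fpq]; first by rewrite dpq.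
  have dqp : d q p = q by have := fpq q; rewrite /flipd dxx.
  apply: (connect_sub_equiv (P := fun u v => same g (d p u) (d q u) -> same g (d p v) (d q v)))
    (skel_conn p z) _ => // [u v t uv vt /uv /vt //|u v Suv|]; last by rewrite dxx dqp.
  case: (skel_decomp Dd Suv) => [duv|fuv]; last first.
    by rewrite (same_mixr p fuv) (same_mixr q fuv).
  move=> guv; apply: same_square Dg guv _ _ _ _ _ _.
  - exact: skel_transl.
  - exact: (skel_transl q (decomp_flip Dd)).
  - exact: (skel_transl p (decomp_flip Dd)).
  - exact: skel_transl.
  - apply: contra neq_pq => /eqP eqz; rewrite -[p]dxx -[X in _ == X]dqp.
    by rewrite -(dl p u) eqz dl.
  - apply: contra neq_pq => /eqP eqz; rewrite -[p]dxx -[X in _ == X]dqp.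
    by rewrite -(dl p v) -eqz dl.
have gxw : g x w = w by rewrite (xw w) gxx.
(* A skeleton path from [x] to [w] may leave their class; [g x] projects it into the class and fixes
   both ends. *)
rewrite -{1}[x]gxx -{1}gxw.
apply: (connect_sub_equiv (P := fun u v => same g (d (g x u) z) (d (g x v) z))) (skel_conn x w).
- by [].
- by move=> u v t; apply: same_trans.
move=> u v Suv; case: (skel_decomp Dg Suv) => [guv|fuv]; last by rewrite (same_mixr x fuv).
apply: edge; first exact: (skel_transl x (decomp_flip Dg)).
exact: same_trans (same_mix x u Dg) (same_sym (same_mix x v Dg)).
Qed.

(** By [same_transl] for [g] and its flip, the left side has the first [g] coordinate of [d x z] and
    the second of [d y z], which determines it. *)
Lemma strict_refinement d g x y z : decomp d -> decomp g ->
  d (g x y) z = g (d x z) (d y z).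
Proof.
move=> Dd Dg; have [gxx _ _ _] := Dg.
have s1 := same_transl z Dd Dg (same_mix x y Dg).
have s2 := same_transl z Dd (decomp_flip Dg) (same_mix_flip x y Dg).
by rewrite -[LHS]gxx s1; apply: same_mixr.
Qed.

End Skeleton.

(** * Decompositions of a prime graph *)

Lemma giso_K1s_eq (T : finType) (e : rel T) : giso e K1s_rel -> forall x y : T, x = y.
Proof. by case=> f [/bij_inj f_inj _] x y; apply: f_inj; case: (f x); case: (f y). Qed.

(** The factors are realised as the two fibres through a base point [o]; primality shrinks one of
    them to a single vertex. *)
Lemma wprime_decomp (T : finType) (e : rel T) (h : T -> T -> T) :
  symmetric e -> wprime e -> decomp e h ->
  (forall x y, h x y = x) \/ (forall x y, h x y = y).
Proof.
move=> sym_e [gt1T prime_e] Dh; have [hxx hl hr hE] := Dh.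
have [o _] : exists o, o \in T by apply/card_gt0P; apply: ltnW.
pose T1 : finType := {x : T | h x o == x}; pose T2 : finType := {x : T | h o x == x}.
pose e1 : rel T1 := fun x y => facrel e h (val x) (val y).
pose e2 : rel T2 := fun x y => facrel e (flipd h) (val x) (val y).
have symF k : symmetric (facrel e k).
  by move=> x y; apply/facrelP/facrelP=> -[v [v' H]]; exists v', v; rewrite sym_e.
have p1 x : h (h x o) o == h x o by rewrite hl.
have p2 x : h o (h o x) == h o x by rewrite hr.
pose f1 x : T1 := exist _ (h x o) (p1 x); pose f2 x : T2 := exist _ (h o x) (p2 x).
have iso : giso e (wprod e1 e2).
  exists (fun x => (f1 x, f2 x)); split.
    exists (fun u => h (val u.1) (val u.2)) => [x|[[x px] [y py]]] /=; first by rewrite hl hr hxx.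
    by congr (_, _); apply: val_inj; rewrite /= ?hl ?hr; apply/eqP.
  by move=> x y; rewrite /wprod /e1 /e2 /= !(facE Dh) -(facrel_edge Dh).
case: (prime_e T1 T2 e1 e2 _ _ iso) => [x y|x y|/giso_K1s_eq e11|/giso_K1s_eq e22]; try exact: symF.
  right=> x y; have /(congr1 val)/= exy := e11 (f1 x) (f1 y).
  by rewrite -(hl x o) exy hl hxx.
left=> x y; have /(congr1 val)/= exy := e22 (f2 y) (f2 x).
by rewrite -(hr x o) exy hr hxx.
Qed.

(** * Connected nonbipartite graphs *)

Lemma nonbip_noiso (T : finType) (e : rel T) :
  gconnected e -> ~ bipartite e -> forall x, exists y, e x y.
Proof.
move=> conn nbip x; case: (pickP (e x)) => [y xy|none]; first by exists y.
(* An isolated vertex would be the whole graph, so a constant colouring would be proper. *)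
case: nbip; exists (fun=> ord0) => u v uv.
by case/connectP: (conn x u) uv => [[|z p]] /=; [move=> _ ->|]; rewrite none.
Qed.

(** Edges carry components of the Boolean square to components; if [x] and a neighbour [x1] lay in
    different ones, these would be the sides of a bipartition. *)
Lemma nonbip_boolsq_connect (T : finType) (e : rel T) :
  symmetric e -> gconnected e -> ~ bipartite e ->
  forall x y, connect (boolsq e) x y.
Proof.
move=> sym_e conn nbip x; set B := boolsq e.
have noiso := nonbip_noiso conn nbip.
have BE u v w : e u w -> e v w -> connect B u v.
  by move=> uw vw; apply: connect1; apply/set0Pn; exists w; rewrite !inE uw vw.
have Bsym : connect_sym B by apply: sym_connect_sym => a b; rewrite /B /boolsq setIC.
have shift u v u' v' : connect B u v -> e u u' -> e v v' -> connect B u' v'.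
  move=> uv; move: u v uv u' v'.
  apply: connect_sub_equiv => [t u' v' tu tv|t y z H1 H2 u' v' tu' zv'|t y].
  - by apply: (BE _ _ t); rewrite sym_e.
  - have [y' yy'] := noiso y; exact: connect_trans (H1 _ _ tu' yy') (H2 _ _ yy' zv').
  case/set0Pn=> w; rewrite !inE => /andP[tw yw] u' v' tu yv.
  apply: (@connect_trans _ _ w); first by apply: (BE _ _ t); rewrite sym_e.
  by apply: (BE _ _ y); rewrite sym_e.
have [x1 xx1] := noiso x.
have step u v : e u v -> (connect B x u -> connect B x1 v) /\ (connect B x1 u -> connect B x v).
  move=> uv; split=> [xu|x1u]; first exact: shift xu xx1 uv.
  by apply: shift x1u _ uv; rewrite sym_e.
have cover v : connect B x v \/ connect B x1 v.
  apply: (connect_sub_equiv (P := fun u v => connect B x u \/ connect B x1 u ->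
    connect B x v \/ connect B x1 v)) (conn x v) _ => [//|a b c ab bc /ab/bc //|a b|].
    by case/step=> H1 H2 [/H1|/H2]; [right|left].
  by left.
have [xx1B y|nx1] := boolP (connect B x x1).
  by case: (cover y) => //; apply: connect_trans.
case: nbip; exists (fun v => if connect B x v then ord0 else ord_max) => u v uv.
have [H1 H2] := step u v uv.
case: (boolP (connect B x u)) => [/H1 x1v|xu].
  by rewrite ifN //; apply: contra nx1 => xv; apply: connect_trans xv _; rewrite Bsym.
by rewrite H2 //; case: (cover u) => // xu'; rewrite xu' in xu.
Qed.

(** * Decompositions of the weak power *)

Section Power.

Variables (T : finType) (e : rel T) (n : nat).
Hypotheses (sym_e : symmetric e) (conn_e : gconnected e) (nbip_e : ~ bipartite e).
Hypotheses (thin_e : R_thin e) (prime_e : wprime e).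

Local Notation X := {ffun 'I_n -> T}.
Local Notation E := (wpow e n).

Definition setc (x : X) (i : 'I_n) (t : T) : X := [ffun k => if k == i then t else x k].

Lemma setc_same x i t : setc x i t i = t.
Proof. by rewrite ffunE eqxx. Qed.

Lemma setc_other x i t k : k != i -> setc x i t k = x k.
Proof. by move=> ki; rewrite ffunE (negPf ki). Qed.

Lemma setc_id x i : setc x i (x i) = x.
Proof. by apply/ffunP=> k; rewrite ffunE; case: eqP => // ->. Qed.

Lemma setc_ind (P : X -> Prop) (x y : X) :
  P x -> (forall z i, P z -> P (setc z i (y i))) -> P y.
Proof.
move=> Px Pset.
suff part k : k <= n -> P [ffun i : 'I_n => if i < k then y i else x i].
  by have := part n (leqnn n); congr P; apply/ffunP=> i; rewrite ffunE ltn_ord.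
elim: k => [_|k IHk lt_kn].
  by move: Px; congr P; apply/ffunP=> i; rewrite ffunE.
have := Pset _ (Ordinal lt_kn) (IHk (ltnW lt_kn)); congr P.
apply/ffunP=> i; rewrite !ffunE ltnS (leq_eqVlt i k) -val_eqE /=.
by case: eqP => [ik|//]; congr (y _); apply: val_inj; rewrite /= ik.
Qed.

Lemma wpow_setc x y i s t : E x y -> e s t -> E (setc x i s) (setc y i t).
Proof. by move=> /forallP xy st; apply/forallP=> k; rewrite !ffunE; case: ifP. Qed.

Lemma wpow_noiso x : exists y, E x y.
Proof.
have noiso t : {u | e t u} by apply: sigW; apply: nonbip_noiso.
by exists [ffun k => sval (noiso (x k))]; apply/forallP=> k; rewrite ffunE; case: (noiso _).
Qed.

Lemma wpow_thin : R_thin E.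
Proof.
move=> x y eqN; apply/ffunP=> i; apply: thin_e => t.
have aux (u v : X) : (forall z, E u z = E v z) -> e (u i) t -> e (v i) t.
  move=> uv uit; have [z uz] := wpow_noiso u.
  have := wpow_setc i uz uit; rewrite setc_id uv => /forallP/(_ i).
  by rewrite setc_same.
by apply/idP/idP; apply: aux.
Qed.

(** Coordinates are changed one at a time along paths in the Boolean square of [e], the others
    stepping to a neighbour and back. *)
Lemma wpow_boolsq_connect x y : connect (boolsq E) x y.
Proof.
have one z i t : connect (boolsq E) z (setc z i t).
  rewrite -{1}[z](setc_id z i).
  apply: (connect_sub_equiv (P := fun s t => connect (boolsq E) (setc z i s) (setc z i t)))
    (nonbip_boolsq_connect sym_e conn_e nbip_e (z i) t) => [//|a b c|a b].
    exact: connect_trans.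
  case/set0Pn=> w; rewrite !inE => /andP[aw bw]; have [z' zz'] := wpow_noiso z.
  by apply: connect1; apply/set0Pn; exists (setc z' i w); rewrite !inE !wpow_setc.
by apply: (setc_ind (x := x) (P := connect (boolsq E) x)) => [//|z i xz]; apply: connect_trans (one _ _ _).
Qed.

Lemma wpow_skel_connect x y : connect (skel E) x y.
Proof.
apply: (connect_sub_equiv (P := connect (skel E))) (wpow_boolsq_connect x y) => //.
  by move=> a b c; apply: connect_trans.
by move=> a b; apply: boolsq_connect_skel.
Qed.

Definition mixc (i : 'I_n) (x y : X) : X := [ffun k => if k == i then x k else y k].

Lemma mixc_decomp i : decomp E (mixc i).
Proof.
split=> [x|x y z|x y z|x x' y y' /forallP xx' /forallP yy'].
- by apply/ffunP=> k; rewrite ffunE if_same.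
- by apply/ffunP=> k; rewrite !ffunE; case: eqP.
- by apply/ffunP=> k; rewrite !ffunE; case: eqP.
by apply/forallP=> k; rewrite !ffunE; case: ifP.
Qed.

Lemma mixc_setc i o s z : mixc i (setc o i s) z = setc z i s.
Proof. by apply/ffunP=> k; rewrite !ffunE; case: eqP. Qed.

(** Because [g] commutes with [mixc i], it acts on every line in direction [i] by the same operation
    [h], a decomposition of the prime graph [e]. *)
Lemma decomp_setc i g : decomp E g ->
  (forall z s t, g (setc z i s) (setc z i t) = setc z i s) \/
  (forall z s t, g (setc z i s) (setc z i t) = setc z i t).
Proof.
move=> Dg; have [gxx gl gr gE] := Dg.
have ref x y z : mixc i (g x y) z = g (mixc i x z) (mixc i y z).
  apply: (strict_refinement wpow_thin wpow_noiso wpow_skel_connect) => //.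
  exact: mixc_decomp.
have [t0 _] : exists t, t \in T by case: prime_e => lt1 _; apply/card_gt0P; apply: ltnW.
pose o : X := [ffun=> t0].
pose h s t := g (setc o i s) (setc o i t) i.
have gh z s t : g (setc z i s) (setc z i t) = setc z i (h s t).
  rewrite -(mixc_setc i o s z) -(mixc_setc i o t z) -ref.
  by apply/ffunP=> k; rewrite !ffunE; case: eqP => // ->.
have Dh : decomp e h.
  split=> [s|s t u|s t u|s s' t t' ss' tt'].
  - by rewrite /h gxx setc_same.
  - by rewrite {1}/h -gh gl.
  - by rewrite {1}/h -gh gr.
  have [o' oo'] := wpow_noiso o.
  have := gE _ _ _ _ (wpow_setc i oo' ss') (wpow_setc i oo' tt').
  by rewrite !gh => /forallP/(_ i); rewrite !setc_same.
by case: (wprime_decomp sym_e prime_e Dh) => hE; [left|right] => z s t; rewrite gh hE.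
Qed.

Lemma wpow_const_off (f : X -> T) (P : pred 'I_n) :
  (forall i, ~~ P i -> forall z s t, f (setc z i s) = f (setc z i t)) ->
  forall x y : X, (forall i, P i -> x i = y i) -> f x = f y.
Proof.
move=> fP x y xy.
suff [] : f x = f y /\ forall i, P i -> x i = y i by [].
apply: (setc_ind (x := x) (P := fun z => f x = f z /\ forall i, P i -> x i = z i)) => // z i [fxz xz].
have [Pi|nPi] := boolP (P i); first by rewrite -(xy i Pi) (xz i Pi) setc_id.
split=> [|k Pk]; first by rewrite fxz -{1}(setc_id z i); apply: fP.
by rewrite setc_other ?xz //; apply: contraNneq nPi => <-.
Qed.

(** * Automorphisms of the weak power *)

Variable s : {perm X}.
Hypothesis aut_s : is_aut E s.

(** The decomposition splitting off coordinate [j] is pulled back along [s]; on lines in direction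
    [i] it becomes one of the two projections. *)
Lemma aut_setc i j :
  (forall z t u, s (setc z i t) j = s (setc z i u) j) \/
  (forall k, k != j -> forall z t u, s (setc z i t) k = s (setc z i u) k).
Proof.
pose g x y := (s^-1)%g (mixc j (s x) (s y)).
have sg x y : s (g x y) = mixc j (s x) (s y) by rewrite /g permKV.
have [mxx ml mr mE] := mixc_decomp j.
have Dg : decomp E g.
  split=> [x|x y z|x y z|x x' y y' xx' yy'].
  - by apply: (@perm_inj _ s); rewrite sg mxx.
  - by apply: (@perm_inj _ s); rewrite !sg ml.
  - by apply: (@perm_inj _ s); rewrite !sg mr.
  by rewrite -aut_s !sg; apply: mE; rewrite aut_s.
case: (decomp_setc i Dg) => gE; [right=> k kj|left] => z t u.
  by rewrite -(gE z t u) sg ffunE (negPf kj).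
by rewrite -(gE z t u) sg ffunE eqxx.
Qed.

Lemma aut_wpowE : exists (p : {perm 'I_n}) (a : 'I_n -> {perm T}),
  (forall k, is_aut e (a k)) /\ forall x k, s x k = a k (x (p k)).
Proof.
have [t1 [t2 neq_t]] : exists t1 t2 : T, t1 != t2.
  by case: prime_e => /card_gt1P[t1 [t2 [_ _ ?]]] _; exists t1, t2.
pose o : X := [ffun=> t1].
(* [f i] is the one output coordinate that input [i] can influence: by injectivity of [s] some
   output [j] moves, and [aut_setc] then freezes all the others. *)
have /fin_all_exists[f fP] i : exists j, forall k, k != j ->
    forall z t u, s (setc z i t) k = s (setc z i u) k.
  case: (boolP [exists j, s (setc o i t1) j != s (setc o i t2) j]) => [/existsP[j]|/existsPn none].
    by move=> nj; exists j; case: (aut_setc i j) => [Hj|//]; rewrite (Hj o t1 t2) eqxx in nj.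
  case/eqP: neq_t; rewrite -(setc_same o i t1) -[RHS](setc_same o i t2).
  congr (fun_of_fin _ i); apply: (@perm_inj _ s); apply/ffunP=> j.
  by apply/eqP; have := none j; rewrite negbK.
(* [f] is onto, since an output influenced by no input would be constant while [s] is onto; [p] is a
   section of [f], hence a permutation. *)
have /fin_all_exists[p pK] k : exists i, f i = k.
  case: (boolP [exists i, f i == k]) => [/existsP[i /eqP]|/existsPn none]; first by exists i.
  case/eqP: neq_t; pose c t : X := (s^-1)%g [ffun=> t].
  have cE t : s (c t) k = t by rewrite permKV ffunE.
  rewrite -(cE t1) -(cE t2); apply: (wpow_const_off (f := fun x => s x k) (P := pred0)) => //.
  by move=> i _; apply: fP; rewrite eq_sym.
have p_inj : injective p := can_inj pK.
have indep i k : i != p k -> forall z t u, s (setc z i t) k = s (setc z i u) k.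
  move=> ik; apply: fP; apply: contra ik => /eqP ->.
  by have [q _ qK] := injF_bij p_inj; rewrite -[i]qK pK.
pose a0 k t := s (setc o (p k) t) k.
have sE x k : s x k = a0 k (x (p k)).
  apply: (wpow_const_off (f := fun x => s x k) (P := pred1 (p k))) => [i|i /eqP ->].
    exact: indep.
  by rewrite setc_same.
have a0_inj k : injective (a0 k).
  move=> t u eq_tu; rewrite -(setc_same o (p k) t) -[RHS](setc_same o (p k) u).
  congr (fun_of_fin _ (p k)); apply: (@perm_inj _ s); apply/ffunP=> l.
  have [->//|lk] := eqVneq l k.
  by apply: indep; apply: contra lk => /eqP /p_inj ->.
exists (perm p_inj), (fun k => perm (@a0_inj k)); split; last by move=> x k; rewrite !permE.
move=> k t u; rewrite !permE; have [o' oo'] := wpow_noiso o.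
apply/idP/idP=> [atu|tu]; last first.
  by have := wpow_setc (p k) oo' tu; rewrite -aut_s => /forallP/(_ k); rewrite !sE !setc_same.
(* For reflection of edges, the edge is placed in coordinate [k], pulled back by the inverse of [s]
   and read at [p k]. *)
have := wpow_setc k oo' atu.
rewrite -{1}[setc o _ _](permKV s) -{1}[setc o' _ _](permKV s) aut_s => /forallP/(_ (p k)).
have key w z : (s^-1)%g (setc w k (a0 k z)) (p k) = z.
  by apply: (@a0_inj k); rewrite -sE permKV setc_same.
by rewrite !key.
Qed.

End Power.

(** * Rigidity from order *)

Lemma perm_mono_id n (p : {perm 'I_n}) :
  (forall k l : 'I_n, k < l -> p k <= p l) -> p = 1%g.
Proof.
move=> mono; apply/permP=> k; rewrite perm1.
have [m] := ubnP (val k); elim: m => // m IHm in k *; rewrite ltnS => le_km.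
pose j := (p^-1)%g k; have pj : p j = k by rewrite permKV.
case: (ltngtP (val j) (val k)) => [lt_jk|lt_kj|/val_inj jk]; last by rewrite -{1}jk.
  by have := IHm j (leq_trans lt_jk le_km); rewrite pj => kj; rewrite kj ltnn in lt_jk.
have := mono _ _ lt_kj; rewrite pj leq_eqVlt => /orP[/eqP/val_inj //|lt_pk].
by apply: (@perm_inj _ p); apply: IHm; apply: leq_trans lt_pk le_km.
Qed.

(** Induction on rank: with everything in [P] below [t] fixed, [u], the preimage of [t] under [a],
    is not below [t]. The pairs [(t, u)] and [(u, u)] force [b t] and [b u] to rank at most that of
    [t], so both equal [t], and [u = t]. *)
Lemma rank_perms_fix (T : finType) (P : pred T) (r : T -> nat) (a b : {perm T}) :
  injective r -> (forall t, P (a t) = P t) -> (forall t, P t -> P (b t)) ->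
  (forall t u, P t -> P u -> r t <= r u -> r (b t) <= r (a u)) ->
  forall t, P t -> a t = t /\ b t = t.
Proof.
move=> r_inj Pa Pb mono t; have [m] := ubnP (r t).
elim: m => // m IHm in t *; rewrite ltnS => le_tm Pt.
have below v : P v -> r v < r t -> a v = v /\ b v = v.
  by move=> Pv vt; apply: IHm => //; apply: leq_trans vt le_tm.
pose u := (a^-1)%g t; have au : a u = t by rewrite permKV.
have Pu : P u by rewrite -Pa au.
have le_tu : r t <= r u.
  rewrite leqNgt; apply/negP=> lt_ut; have [] := below u Pu lt_ut; rewrite au => tu _.
  by rewrite -tu ltnn in lt_ut.
have bfix v : P v -> r v >= r t -> r (b v) <= r t -> b v = t.
  move=> Pv tv; rewrite leq_eqVlt => /orP[/eqP/r_inj //|lt_bv].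
  have [_ /perm_inj bv] := below _ (Pb _ Pv) lt_bv.
  by move: lt_bv; rewrite bv ltnNge tv.
have bt : b t = t by apply: bfix => //; rewrite -{2}au; apply: mono.
have bu : b u = t by apply: bfix => //; rewrite -{1}au; apply: mono.
have ut : u = t by apply: (@perm_inj _ b); rewrite bu bt.
by split; rewrite // -{1}ut.
Qed.

(** * Symmetries preserving the extra colour *)

Section Coloring.

Variables (T : finType) (m : nat) (P : pred T).

Local Notation X := {ffun 'I_m.+4 -> T}.

Let i0 : 'I_m.+4 := ord0.
Let i1 : 'I_m.+4 := @Ordinal m.+4 1 isT.
Let i2 : 'I_m.+4 := @Ordinal m.+4 2 isT.
Let i3 : 'I_m.+4 := @Ordinal m.+4 3 isT.

Definition marked (x : X) :=
  [&& P (x i0), P (x i1), enum_rank (x i1) <= enum_rank (x i0) &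
      [forall k : 'I_m.+4, forall l : 'I_m.+4,
         (2 <= k < l) ==> (x l == x i0) ==> (x k == x i0)]].

Definition point (a t : T) (f : 'I_m.+4 -> T) : X :=
  [ffun k => if k == i0 then a else if k == i1 then t else f k].

Lemma point_ge2 a t f (k : 'I_m.+4) : 2 <= k -> point a t f k = f k.
Proof. by case: k => -[|[|k]] // ltk _; rewrite ffunE. Qed.

Lemma marked_point a t (f : 'I_m.+4 -> T) : P a -> P t -> enum_rank t <= enum_rank a ->
  (forall k l : 'I_m.+4, 2 <= k < l -> f l = a -> f k = a) -> marked (point a t f).
Proof.
move=> Pa Pt le_ta fP; rewrite /marked ![point _ _ _ _]ffunE /= Pa Pt le_ta /=.
apply/forallP=> k; apply/forallP=> l; apply/implyP=> /andP[le2k lt_kl].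
rewrite !point_ge2 //; last exact: leq_trans (ltnW lt_kl).
by apply/implyP=> /eqP /fP fk; apply/eqP; apply: fk; rewrite le2k.
Qed.

Lemma marked_tail x (k l : 'I_m.+4) : marked x -> 2 <= k < l -> x l = x i0 -> x k = x i0.
Proof.
case/and4P=> _ _ _ /forallP/(_ k)/forallP/(_ l)/implyP H /H /implyP H' /eqP /H' /eqP //.
Qed.

Variables (p : {perm 'I_m.+4}) (a : 'I_m.+4 -> {perm T}).

(** The wreath product action: [p] permutes coordinates and [a] acts on entries. *)
Definition wr (x : X) : X := [ffun k => a k (x (p k))].

Hypotheses (gt2T : 2 < #|T|) (z0 : T) (Pz0 : P z0) (z1 : T) (nPz1 : ~~ P z1).
Hypothesis rigid : forall k, (forall t, P t -> a k t = t) -> a k = 1%g.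
Hypothesis P_wr : forall x, P (wr x i0) = P (x i0).
Hypothesis marked_wr : forall x, marked x -> marked (wr x).

Lemma exists_third (s t : T) : exists u, (u != s) && (u != t).
Proof.
have : 0 < #|~: [set s; t]|.
  have := cardsC [set s; t]; have : #|[set s; t]| <= 2 by rewrite cards2; case: (_ != _).
  by case: #|~: _| => //; rewrite addn0 => le2 eq2; rewrite eq2 leqNgt gt2T in le2.
by case/card_gt0P=> u; rewrite !inE negb_or => ?; exists u.
Qed.

Lemma wr_p0 : p i0 = i0.
Proof.
(* [x z0] and [x z1] differ only in coordinate 0; if the image did not read it there, [P] could not
   separate them. *)
apply/eqP; apply: contraT => p0; pose x t : X := [ffun k => if k == i0 then t else z0].
have := P_wr (x z0); have := P_wr (x z1); rewrite !ffunE (negPf p0) /= => ->.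
by rewrite Pz0 (negPf nPz1).
Qed.

Lemma wr_P0 t : P (a i0 t) = P t.
Proof. by have := P_wr [ffun=> t]; rewrite !ffunE. Qed.

Lemma wr_p1 : p i1 = i1.
Proof.
apply/eqP; apply: contraT => p1.
have p1' : p i1 != i0 by rewrite -[X in _ != X]wr_p0 (inj_eq perm_inj).
(* If coordinate 1 of the image were read from the tail, this constant tail would put [z1], which is
   outside [P], there. *)
have /and4P[_ + _ _] : marked (wr (point z0 z0 (fun=> (a i1)^-1%g z1))).
  by apply/marked_wr/marked_point.
by rewrite !ffunE (negPf p1) (negPf p1') permKV (negPf nPz1).
Qed.

(** Constant tails satisfy the initial-segment clause, so entries 0 and 1 can be compared freely and
    [rank_perms_fix] applies. *)
Lemma wr_fix01 t : P t -> a i0 t = t /\ a i1 t = t.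
Proof.
have mk t1 u : P t1 -> P u -> enum_rank t1 <= enum_rank u ->
    marked (wr (point u t1 (fun=> u))).
  by move=> *; apply/marked_wr/marked_point.
apply: (@rank_perms_fix T P (fun t => enum_rank t)).
- by move=> u v /ord_inj /enum_rank_inj.
- exact: wr_P0.
- move=> u Pu; have /and4P[_ + _ _] := mk u u Pu Pu (leqnn _).
  by rewrite ffunE wr_p1 ffunE.
move=> u v Pu Pv le_uv; have /and4P[_ _ + _] := mk u v Pu Pv le_uv.
by rewrite !ffunE wr_p1 wr_p0.
Qed.

Lemma p_ge2 (k : 'I_m.+4) : 2 <= k -> 2 <= p k.
Proof.
move=> le2k; rewrite ltnNge; apply/negP=> le_pk.
have : p k \in [:: p i0; p i1] by rewrite wr_p0 wr_p1 !inE -!val_eqE /=; case: (val _) le_pk => [|[]].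
by rewrite !inE !(inj_eq perm_inj); case: k le2k {le_pk} => -[|[]].
Qed.

(** Entry 0 stays [t] by [wr_fix01], so the initial-segment clause of the image is about its entries
    equal to [t]. *)
Lemma wr_tail t (f : 'I_m.+4 -> T) (k l : 'I_m.+4) : P t ->
  (forall k l : 'I_m.+4, 2 <= k < l -> f l = t -> f k = t) ->
  2 <= k < l -> a l (f (p l)) = t -> a k (f (p k)) = t.
Proof.
move=> Pt fP lekl; have := marked_wr (marked_point Pt Pt (leqnn _) fP).
move=> /marked_tail/(_ lekl); case/andP: lekl => le2k lt_kl.
rewrite ![wr _ _]ffunE wr_p0 [point _ _ _ i0]ffunE /= (wr_fix01 Pt).1.
by rewrite !point_ge2 //; apply: p_ge2 => //; apply: leq_trans (ltnW lt_kl).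
Qed.

Lemma wr_fix k t : P t -> a k t = t.
Proof.
move=> Pt.
have fix_gt2 (l : 'I_m.+4) : 2 < l -> a l t = t.
  move=> lt2l; pose u := (a l)^-1%g t.
  have [ut|ut] := eqVneq u t; first by rewrite -{1}ut permKV.
  (* The tail [u] at [p l], [w] elsewhere avoids [t], so it is admissible. Its image has [t] at [l],
     hence at index 2, which forces [w = v]. *)
  pose v := (a i2)^-1%g t; have [w /andP[wt wv]] := exists_third t v.
  have := @wr_tail t (fun j => if j == p l then u else w) i2 l Pt.
  rewrite eqxx (inj_eq perm_inj) ifN; last by apply: contraTneq lt2l => <-.
  rewrite permKV => aw; case/eqP: wv; rewrite /v -aw ?permK // => j j' _.
  by case: eqP => _ eqt; [case/eqP: ut|case/eqP: wt].
have [lt2k|] := ltnP 2 k; first exact: fix_gt2.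
case: k => -[|[|[|k]]] // ltk _.
- by rewrite (_ : Ordinal _ = i0) ?(wr_fix01 Pt).1 //; apply: val_inj.
- by rewrite (_ : Ordinal _ = i1) ?(wr_fix01 Pt).2 //; apply: val_inj.
rewrite (_ : Ordinal _ = i2); last exact: val_inj.
(* The constant tail [t] gives [t] at index 3 of the image, hence at index 2; the fourth coordinate
   is used here. *)
by apply: (wr_tail (f := fun=> t) (l := i3)) => //; apply: fix_gt2.
Qed.

Lemma wr_perm1 k : a k = 1%g.
Proof. by apply: rigid => t; apply: wr_fix. Qed.

Lemma wr_index1 : p = 1%g.
Proof.
apply: perm_mono_id => k l lt_kl.
have [le2k|] := leqP 2 k; last first.
  case: k lt_kl => -[|[|k]] // ltk lt_kl _.
    by rewrite (_ : Ordinal _ = i0) ?wr_p0 //; apply: val_inj.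
  rewrite (_ : Ordinal _ = i1) ?wr_p1; last exact: val_inj.
  by apply: (leq_trans _ (p_ge2 _)).
(* The tail is [z0] exactly up to index [p l]; the image has [z0] at [l], hence at [k], so
   [p k <= p l]. *)
have [w /andP[wz _]] := exists_third z0 z0.
have := @wr_tail z0 (fun j => if j <= p l then z0 else w) k l Pz0.
rewrite le2k lt_kl leqnn !wr_perm1 !perm1; case: leqP => // _ H.
suff /eqP : w = z0 by rewrite (negPf wz).
apply: H => // j j' /andP[_ lt_jj']; case: ifP => [le_j' _|_ /eqP]; last by rewrite (negPf wz).
by rewrite (leq_trans (ltnW lt_jj') le_j').
Qed.

End Coloring.

Theorem mainTheorem6 (T : finType) (e : rel T) (chi : nat) :
  simple_graph e ->
  gconnected e ->
  ~ bipartite e ->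
  R_thin e ->
  3 <= #|T| ->
  wprime e ->
  chromatic_number e chi ->
  (exists (c : T -> 'I_chi) (i : 'I_chi),
      proper_coloring e c /\
      forall s : {perm T}, is_aut e s -> (forall x, c x = i -> s x = x) -> s = 1%g) ->
  forall n : nat, 4 <= n -> chiD_le (wpow e n) chi.+1.
Proof.
move=> [sym_e _] conn nbip thin gt2T prime_e _ [c [i' [proper_c rigid']]] [|[|[|[|m]]]] // _.
have [t0 _] : exists t0, t0 \in T by apply/card_gt0P; apply: leq_trans gt2T.
(* If the class is empty, then G is rigid and any other class will do. *)
have [i [z0 cz0] rigid] : exists2 i : 'I_chi, exists z0, c z0 = i &
    forall s : {perm T}, is_aut e s -> (forall x, c x = i -> s x = x) -> s = 1%g.
  case: (pickP (fun z => c z == i')) => [z /eqP cz|none]; first by exists i' => //; exists z.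
  exists (c t0); first by exists t0.
  by move=> s aut_s _; apply: rigid' => // x /eqP; rewrite none.
have [z1 ez1] := nonbip_noiso conn nbip z0.
pose P := [pred t | c t == i]; pose M := @marked T m P.
(* The extra colour [ord_max] thus still determines the colour of coordinate 0; this gives
   properness, and colour-preserving automorphisms keep that colour. *)
have M0 x : M x -> c (x ord0) = i by case/and4P=> /eqP.
pose col x := if M x then ord_max else lift ord_max (c (x ord0)).
have colM x : (col x == ord_max) = M x.
  by rewrite /col; case: (M x); rewrite ?eqxx // eq_sym (negPf (neq_lift _ _)).
exists col; split=> [x y /forallP/(_ ord0) /proper_c neq_c|s aut_s col_s].
  apply: contra neq_c => /eqP eq_col.
  have eqM : M x = M y by rewrite -!colM eq_col.
  move: eq_col; rewrite /col eqM; case: ifP => [My _|_ /lift_inj -> //].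
  by rewrite !M0 ?eqM.
have [p [a [aut_a sE]]] := aut_wpowE sym_e conn nbip thin prime_e aut_s.
have swr x : s x = wr p a x by apply/ffunP=> k; rewrite sE ffunE.
have Ms x : M (s x) = M x by rewrite -!colM col_s.
have cs x : c (s x ord0) = c (x ord0).
  have := col_s x; rewrite /col Ms; case: ifP => [Mx _|_ /lift_inj //].
  by rewrite !M0 ?Ms.
have Pz0 : P z0 by apply/eqP.
have nPz1 : ~~ P z1 by rewrite /= -cz0 eq_sym; apply: proper_c.
have rig k : (forall t, P t -> a k t = t) -> a k = 1%g.
  by move=> fixP; apply: rigid => // t /eqP; apply: fixP.
have Pwr x : P (wr p a x ord0) = P (x ord0) by rewrite /= -swr cs.
have Mwr x : marked P x -> marked P (wr p a x) by rewrite -swr [marked P (s x)]Ms.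
apply/permP=> x; rewrite perm1 swr; apply/ffunP=> k.
by rewrite ffunE (wr_perm1 gt2T Pz0 nPz1 rig Pwr Mwr) (wr_index1 gt2T Pz0 nPz1 rig Pwr Mwr) !perm1.
Qed.
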